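(* Let $(\mathcal{V},g)$ be a (possibly indefinite) scalar product space. Suppose there exists a Jacobi-proportional Jacobi-diagonalizable $k$-root Osserman algebraic curvature tensor $R$ on $(\mathcal{V},g)$ whose reduced Jacobi operators satisfy $\det(\lambda\,\mathrm{Id}-\widetilde{\mathcal{J}}_X)=\prod_{i=1}^k(\lambda-\varepsilon_X\lambda_i)^{\nu_i}$ for every nonnull $X\in\mathcal{V}$, with distinct $\lambda_1,\dots,\lambda_k\in\mathbb{R}$ and multiplicities $\nu_1,\dots,\nu_k$. Then for any scalars $\mu_1,\dots,\mu_k\in\mathbb{R}$ there is an Osserman algebraic curvature tensor on $(\mathcal{V},g)$ whose reduced Jacobi operators $\widetilde{\mathcal{J}}'_X$ satisfy $\det(\lambda\,\mathrm{Id}-\widetilde{\mathcal{J}}'_X)=\prod_{i=1}^k(\lambda-\varepsilon_X\mu_i)^{\nu_i}$ for every nonnull $X\in\mathcal{V}$.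
   Context: A scalar product space $(\mathcal{V},g)$ is a finite-dimensional real vector space $\mathcal{V}$ with a nondegenerate symmetric bilinear form $g$, not necessarily positive definite. Write $\varepsilon_X=g(X,X)$; $X\in\mathcal{V}$ is nonnull if $\varepsilon_X\neq 0$. An algebraic curvature tensor on $(\mathcal{V},g)$ is a multilinear map $R\colon\mathcal{V}^4\to\mathbb{R}$ such that for all $X,Y,Z,W\in\mathcal{V}$: $R(X,Y,Z,W)=-R(Y,X,Z,W)$; $R(X,Y,Z,W)=-R(X,Y,W,Z)$; $R(X,Y,Z,W)+R(Y,Z,X,W)+R(Z,X,Y,W)=0$; and (as a consequence) $R(X,Y,Z,W)=R(Z,W,X,Y)$. The Jacobi operator of $R$ at $X$ is the linear map $\mathcal{J}_X\colon\mathcal{V}\to\mathcal{V}$ determined by $g(\mathcal{J}_XY,W)=R(Y,X,X,W)$ for all $Y,W\in\mathcal{V}$. It is self-adjoint with $\mathcal{J}_XX=0$, so for nonnull $X$ it restricts to the reduced Jacobi operator $\widetilde{\mathcal{J}}_X\colon X^\perp\to X^\perp$. $R$ is Osserman if the polynomial $\det(\lambda\,\mathrm{Id}-\mathcal{J}_X/\varepsilon_X)$ in $\lambda$ is independent of the nonnull vector $X\in\mathcal{V}$. $R$ is $k$-root if, for every nonnull $X$, $\widetilde{\mathcal{J}}_X$ has exactly $k$ distinct eigenvalues (counting complex roots). $R$ is Jacobi-diagonalizable if for each nonnull $X$ there is an orthonormal basis of $\mathcal{V}$ consisting of eigenvectors of $\mathcal{J}_X$ (orthonormal meaning $g(E_i,E_j)=0$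 for $i\neq j$ and $g(E_i,E_i)\in\{1,-1\}$). For a Jacobi-diagonalizable $k$-root Osserman $R$, the distinct eigenvalues of $\widetilde{\mathcal{J}}_X$ are $\varepsilon_X\lambda_1,\dots,\varepsilon_X\lambda_k$ with $\lambda_1,\dots,\lambda_k\in\mathbb{R}$ independent of the nonnull $X$. Put $\mathcal{V}_0(X)=\mathrm{Span}\{X\}$ and $\mathcal{V}_i(X)=\ker(\widetilde{\mathcal{J}}_X-\varepsilon_X\lambda_i\mathrm{Id})\subseteq X^\perp$ for $1\le i\le k$; then $\mathcal{V}=\bigoplus_{i=0}^k\mathcal{V}_i(X)$ is an orthogonal direct sum. A Jacobi-diagonalizable $k$-root Osserman $R$ is Jacobi-proportional if for every pair of nonnull vectors $X,Y\in\mathcal{V}$, decomposed as $X=\sum_{i=0}^kX_i$ and $Y=\sum_{j=0}^kY_j$ with $X_i\in\mathcal{V}_i(Y)$ and $Y_j\in\mathcal{V}_j(X)$, one has $\varepsilon_X\varepsilon_{Y_i}=\varepsilon_Y\varepsilon_{X_i}$ for all $0\le i\le k$. *)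

(* Defs.v *)
From HB Require Import structures.
From mathcomp Require Import all_boot all_order all_algebra.
From mathcomp Require Import reals lra.
From mathcomp.real_closed Require Import complex.

Set Implicit Arguments.
Unset Strict Implicit.
Unset Printing Implicit Defensive.

Import Order.TTheory GRing.Theory Num.Theory.
Import passmx.

Local Open Scope ring_scope.

Section LinearAlgebra.
Variables (K : realType) (V : vectType K).

(* \det (lambda Id - f), computed in an arbitrary basis. *)
Definition lfun_char_poly (f : 'End(V)) : {poly K} :=
  char_poly (mxof (vbasis fullv) (vbasis fullv) f).

End LinearAlgebra.

Section CurvatureTensors.
Variables (K : realType) (V : vectType K).

(* The pair symmetry R(X,Y,Z,W) = R(Z,W,X,Y) is a consequence of the other
   identities: see [alg_curvature_pair_sym]. *)
Record alg_curvature (R : V -> V -> V -> V -> K) : Prop := AlgCurvature {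
  curv_linear1 : forall Y Z W, scalar (fun X => R X Y Z W);
  curv_linear2 : forall X Z W, scalar (fun Y => R X Y Z W);
  curv_linear3 : forall X Y W, scalar (fun Z => R X Y Z W);
  curv_linear4 : forall X Y Z, scalar (fun W => R X Y Z W);
  curv_skew12 : forall X Y Z W, R X Y Z W = - R Y X Z W;
  curv_skew34 : forall X Y Z W, R X Y Z W = - R X Y W Z;
  curv_bianchi : forall X Y Z W, R X Y Z W + R Y Z X W + R Z X Y W = 0
}.

Lemma alg_curvature_pair_sym R : alg_curvature R ->
  forall X Y Z W, R X Y Z W = R Z W X Y.
Proof.
move=> [_ _ _ _ s12 s34 b] X Y Z W.
have := (b X Y Z W, b Y Z W X, b Z W X Y, b W X Y Z).
rewrite (s12 Z X) (s34 Y Z W) (s34 Z W Y) (s12 W Y Z) (s34 Y W Z).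
rewrite (s12 W X) (s34 X W Z) (s34 X Z W) (s12 W X) (s34 X Y W).
by case=> [[[]]]; lra.
Qed.

Variable g : {symmetric V}.

Definition eps (X : V) : K := g X X.

Definition nonnull (X : V) : Prop := eps X != 0.

Definition flat : 'Hom(V, 'Hom(V, K^o)) :=
  linfun (fun Y : V => linfun (fun W : V => g Y W : K^o) : 'Hom(V, K^o)).

Variable R : V -> V -> V -> V -> K.

(* The vector J_X Y representing the covector R(Y,X,X,-) through g: this is the
   linear map characterized by [jacobiP] when g is nondegenerate. *)
Definition jacobi (X : V) : 'End(V) :=
  linfun (fun Y : V => (flat^-1)%VF (linfun (fun W : V => R Y X X W : K^o))).

(* J_X preserves X^perp (see [red_jacobiP]), so the projection is only a
   coercion to the subspace. *)
Definition red_jacobi (X : V) : 'End(subvs_of (orthov g <[X]>)) :=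
  linfun (fun Y => vsproj (orthov g <[X]>) (jacobi X (vsval Y))).

Definition osserman : Prop :=
  forall X Y, nonnull X -> nonnull Y ->
    lfun_char_poly ((eps X)^-1 *: jacobi X) =
    lfun_char_poly ((eps Y)^-1 *: jacobi Y).

Definition k_root (k : nat) : Prop :=
  forall X, nonnull X ->
    exists s : seq K[i],
      [/\ uniq s, size s = k &
          forall z, (z \in s) =
            root (map_poly (real_complex K) (lfun_char_poly (red_jacobi X))) z].

Definition jacobi_diagonalizable : Prop :=
  forall X, nonnull X ->
    exists E : (\dim {:V}).-tuple V,
      [/\ basis_of fullv E,
          forall i j, i != j -> g (tnth E i) (tnth E j) = 0,
          forall i, g (tnth E i) (tnth E i) = 1 \/
                    g (tnth E i) (tnth E i) = -1 &
          forall i, exists a : K, jacobi X (tnth E i) = a *: tnth E i].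

(* lam lists without repetition the lambda_i such that, for every nonnull X, the
   eigenvalues of the reduced Jacobi operator at X are the eps X * lambda_i. *)
Definition red_eigenvalues (k : nat) (lam : 'I_k -> K) : Prop :=
  injective lam /\
  forall X, nonnull X ->
    forall a : K, leigenvalue (red_jacobi X) a <-> exists i, a = eps X * lam i.

(* The subspaces V_0(X) = <[X]> and V_(i+1)(X), the eigenspace, seen inside V,
   of the reduced Jacobi operator for eps X * lam i (i : 'I_k). *)
Definition jacobi_space (k : nat) (lam : 'I_k -> K) (X : V) (i : 'I_k.+1) :
    {vspace V} :=
  if unlift ord0 i is Some j then
    (linfun vsval @: leigenspace (red_jacobi X) (eps X * lam j))%VS
  else <[X]>%VS.

(* Meant for Jacobi-diagonalizable k-root Osserman R, for which the family lam
   exists; it is then unique up to reindexing, on which the condition does not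
   depend. *)
Definition jacobi_proportional (k : nat) : Prop :=
  forall lam : 'I_k -> K, red_eigenvalues lam ->
  forall (X Y : V) (Xs Ys : 'I_k.+1 -> V), nonnull X -> nonnull Y ->
    (forall i, Xs i \in jacobi_space lam Y i) -> X = \sum_i Xs i ->
    (forall j, Ys j \in jacobi_space lam X j) -> Y = \sum_j Ys j ->
  forall i, eps X * eps (Ys i) = eps Y * eps (Xs i).

Hypotheses (g_nondeg : nondegenerate g) (R_curv : alg_curvature R).

Let covector_linear (f : V -> K) (f_lin : scalar f) :
  forall W, (linfun (f : V -> K^o)) W = f W.
Proof.
pose F := GRing.isLinear.Build K V K^o _ (f : V -> K^o) f_lin.
pose f' : {linear V -> K^o} := HB.pack (f : V -> K^o) F.
by move=> W; rewrite -[f]/(f' : V -> K^o) lfunE.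
Qed.

Lemma flatE Y W : flat Y W = g Y W.
Proof.
have gl U : scalar (g U) by move=> a A B; rewrite linearPr.
have fl : linear (fun U : V => linfun (fun W' : V => g U W' : K^o)).
  move=> a A B; apply/lfunP => C.
  by rewrite add_lfunE scale_lfunE !covector_linear //= linearPl.
pose f' : {linear V -> 'Hom(V, K^o)} :=
  HB.pack (fun U : V => linfun (fun W' : V => g U W' : K^o))
    (GRing.isLinear.Build K V 'Hom(V, K^o) _ _ fl).
have -> : flat Y = f' Y by rewrite -[LHS]/(linfun f' Y) lfunE.
by rewrite covector_linear.
Qed.

Lemma flatK : (flat \o flat^-1 = \1)%VF.
Proof.
apply/lfunP=> x; rewrite comp_lfunE id_lfunE; apply: limg_lfunVK.
suff -> : limg flat = fullv by rewrite memvf.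
apply/eqP; rewrite -dimv_leqif_eq ?subvf //.
rewrite limg_dim_eq ?capfv; first by rewrite !dimvf /dim /= muln1.
apply/eqP; rewrite -subv0; apply/subvP => Y.
rewrite memv_ker /= => /eqP/lfunP Y0; rewrite -(eqP g_nondeg).
by apply/mem_orthovP => W _; rewrite -flatE Y0 lfunE.
Qed.

Lemma jacobiP X Y W : g (jacobi X Y) W = R Y X X W.
Proof.
case: R_curv => l1 _ _ l4 _ _ _.
have cl : linear (fun Y : V => (flat^-1)%VF (linfun (fun W : V => R Y X X W : K^o))).
  move=> a A B; rewrite -linearP; congr (_ _); apply/lfunP=> C.
  by rewrite add_lfunE scale_lfunE !covector_linear // l1.
pose f' : {linear V -> V} := HB.pack (fun Y : V => _)
  (GRing.isLinear.Build K V V _ _ cl).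
have -> : jacobi X Y = f' Y by rewrite -[LHS]/(linfun f' Y) lfunE.
rewrite -flatE /f' /= -[flat _]comp_lfunE flatK id_lfunE.
by rewrite covector_linear.
Qed.

Lemma red_jacobiP X Y : vsval (red_jacobi X Y) = jacobi X (vsval Y).
Proof.
rewrite /red_jacobi.
rewrite (lfunE (vsproj (orthov g <[X]>) \o jacobi X \o vsval)) /=.
rewrite vsprojK // mem_orthov1 jacobiP.
case: R_curv => _ _ _ _ _ s34 _; apply/eqP.
have := s34 (vsval Y) X X X; lra.
Qed.

End CurvatureTensors.

(* Main.v *)
Require Import Defs.
From HB Require Import structures.
From mathcomp Require Import all_boot all_order all_algebra.
From mathcomp Require Import reals boolp ring lra.
From mathcomp.real_closed Require Import complex.

Set Implicit Arguments.
Unset Strict Implicit.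
Unset Printing Implicit Defensive.

Import Order.TTheory GRing.Theory Num.Theory.
Import passmx.

Local Open Scope ring_scope.

(* Replace the eigenvalue eps_X lam_i of the reduced Jacobi operator by
   eps_X mu_i on the same eigenspace V_i(X), and let S_X(Y, W) = g(J'_X Y, W)
   for the resulting operator J'_X.  In terms of the decomposition of Y along X,
   S_X(Y, Y) = eps_X sum_i mu_i eps(Y_i), so Jacobi-proportionality yields
   S_X(Y, Y) = S_Y(X, X) for nonnull X and Y.  Being quadratic in Y,
   S_X(Y, Y) is then also quadratic in X on the nonnull vectors; evaluating at
   the nonnull vectors E_a and E_a + 2 E_b of an orthonormal basis produces a
   form T(X, X', Y, W), symmetric in each pair and under exchange of the pairs,
   with T(X, X, Y, W) = S_X(Y, W) for nonnull X.  The curvature tensor is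
   2/3 (T(B, C, A, D) - T(A, C, B, D)). *)

(** * Roots, eigenvectors and characteristic polynomials *)

Lemma prod_XsubC_map (F : fieldType) (k : nat) (l : 'I_k -> F)
    (nu : 'I_k -> nat) (h : F -> F) (s : seq F) :
  \prod_(c <- s) ('X - c%:P) = \prod_i ('X - (l i)%:P) ^+ nu i ->
  \prod_(c <- s) ('X - (h c)%:P) = \prod_i ('X - (h (l i))%:P) ^+ nu i.
Proof.
pose t := flatten [seq nseq (nu i) (l i) | i <- enum 'I_k].
have prod_t (f : F -> F) :
    \prod_i ('X - (f (l i))%:P) ^+ nu i = \prod_(c <- t) ('X - (f c)%:P).
  rewrite big_flatten big_map big_enum /=; apply: eq_bigr => i _.
  by rewrite big_nseq -Monoid.iteropE.
(* Unique factorization makes [s] a permutation of [t], the list of the [l i] with multiplicity;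
   applying [h] to both lists preserves this. *)
by rewrite (prod_t id) prod_t => /prod_XsubC_eq st; apply: perm_big.
Qed.

Section LinearMaps.
Variable F : fieldType.

Lemma exists_free_subseq (V : vectType F) (s : seq V) :
  exists t : seq V, [/\ {subset t <= s}, free t & <<t>>%VS = <<s>>%VS].
Proof.
elim: s => [|v s [t [ts ft et]]]; first by exists [::]; rewrite nil_free.
have [vt|vNt] := boolP (v \in <<t>>%VS).
  exists t; split=> // [u /ts us|]; first by rewrite inE us orbT.
  rewrite span_cons -et; apply/esym/addv_idPr; exact: vt.
exists (v :: t); split; last by rewrite !span_cons et.
- move=> u; rewrite !inE => /orP[->//|/ts ->]; exact: orbT.
- by rewrite free_cons vNt.
Qed.

Lemma exists_lfun_of_free (V W : vectType F) (s : seq V) (f : V -> W) :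
  free s -> exists h : 'Hom(V, W), {in s, forall v, h v = f v}.
Proof.
move=> fs; have [h] := linear_of_free s (map f s).
move=> /(_ fs (size_map _ _))/eq_in_map hf.
by exists (linfun h) => v vs; rewrite lfunE hf.
Qed.

(** Comparing coordinates in [f w = a *: w] shows that [b v = a] for every [v] with a nonzero
    coefficient in [w]; hence [f'] scales each such term by [h a]. *)
Lemma eigenvec_transfer (V : vectType F) (s : seq V) (f f' : 'End(V))
    (b : V -> F) (h : F -> F) :
  free s -> {in s, forall v, f v = b v *: v} ->
  {in s, forall v, f' v = h (b v) *: v} ->
  forall (w : V) (a : F), w \in <<s>>%VS -> f w = a *: w -> f' w = h a *: w.
Proof.
move=> fs fE f'E w a ws fw.
have [c wE _] := free_span fs ws.
have [d _ dP] := free_span fs (memvZ a ws).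
have ca : {in s, (fun x => c x * b x) =1 d}.
  apply: dP; rewrite -fw wE linear_sum; apply: eq_big_seq => v vs.
  by rewrite /= linearZ /= fE // scalerA.
have cb : {in s, (fun x => a * c x) =1 d}.
  apply: dP; rewrite wE scaler_sumr; apply: eq_bigr => v _.
  by rewrite scalerA.
rewrite wE linear_sum scaler_sumr; apply: eq_big_seq => v vs.
rewrite /= linearZ /= f'E // !scalerA mulrC; congr (_ *: _).
have [-> //|cv0] := eqVneq (c v) 0; first by rewrite !mulr0.
congr (h _ * _); apply: (mulfI cv0).
by rewrite (ca v vs) [RHS]mulrC (cb v vs).
Qed.

Lemma basis_vsproj (V : vectType F) (U : {vspace V}) (s : seq V) :
  basis_of U s -> basis_of fullv [seq vsproj U v | v <- s].
Proof.
move=> bs; rewrite basisEdim size_map dimvf /=.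
have -> : dim (subvs_of U) = \dim U by [].
rewrite (size_basis (X := in_tuple s) bs) leqnn andbT.
apply/subvP => w _; rewrite -(vsvalK w).
have : vsval w \in <<s>>%VS by rewrite (span_basis bs) subvsP.
case/(free_span (basis_free bs)) => c -> _; rewrite linear_sum big_seq.
apply: memv_suml => v vs; rewrite /= linearZ memvZ // memv_span //.
exact: map_f.
Qed.

End LinearMaps.

(** The matrices of [f] in two bases are conjugate by the change-of-basis matrices [P] and [Q], and
    conjugation leaves the determinant unchanged. *)
Lemma lfun_char_poly_basis (K : realType) (V : vectType K)
    (e : (\dim {:V}).-tuple V) (f : 'End(V)) :
  basis_of fullv e -> lfun_char_poly f = char_poly (mxof e e f).
Proof.
move=> be; pose v := vbasis {:V}; have bv : basis_of fullv v := vbasisP _.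
pose P := mxof v e \1%VF; pose Q := mxof e v \1%VF.
have PQ : P *m Q = 1%:M.
  by rewrite /P /Q -mxof_comp // comp_lfun1l mxof1 // (basis_free bv).
have fE : mxof v v f = P *m mxof e e f *m Q.
  by rewrite /P /Q -!mxof_comp // comp_lfun1l comp_lfun1r.
rewrite /lfun_char_poly -/v fE /char_poly /char_poly_mx !map_mxM.
have PQX : map_mx polyC P *m map_mx polyC Q = 1%:M.
  by rewrite -map_mxM PQ map_mx1.
rewrite -[X in X - _]mul1mx -PQX -[X in X - _]mulmxA scalar_mxC.
rewrite [X in X - _]mulmxA -mulmxBl -mulmxBr !det_mulmx mulrAC -det_mulmx.
by rewrite PQX det1 mul1r.
Qed.

Lemma lfun_char_poly_eigenbasis (K : realType) (V : vectType K)
    (s : seq V) (f : 'End(V)) (b : V -> K) :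
  basis_of fullv s -> {in s, forall v, f v = b v *: v} ->
  lfun_char_poly f = \prod_(v <- s) ('X - (b v)%:P).
Proof.
move=> bs fE; have ss := size_basis (X := in_tuple s) bs.
pose e : (\dim {:V}).-tuple V := tcast (esym ss) (in_tuple s).
have es : e = s :> seq V by rewrite val_tcast.
have be : basis_of fullv e by rewrite es.
have M i j : mxof e e f i j = (b e`_i) *+ (i == j).
  rewrite mxE /= vecof_delta mxE fE; last first.
    by rewrite -es mem_nth // size_tuple.
  by rewrite linearZ /= coord_free ?(basis_free be) // mulr_natr eq_sym.
rewrite (lfun_char_poly_basis _ be) char_poly_trig; last first.
  by apply/is_trig_mxP => i j ij; rewrite M lt_eqF.
rewrite -es (big_nth 0) size_tuple big_mkord; apply: eq_bigr => i _.
by rewrite M eqxx.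
Qed.

Lemma leigenvalue_root (K : realType) (V : vectType K) (f : 'End(V)) (a : K) :
  leigenvalue f a = root (lfun_char_poly f) a.
Proof.
rewrite /lfun_char_poly -eigenvalue_root_char /leigenvalue /eigenvalue.
by rewrite (leigenspaceE (vbasisP _)) vsof_eq0 // vbasisP.
Qed.

(** * Jacobi operators and their eigenspaces *)

Section ScalarProduct.
Variables (K : realType) (V : vectType K) (g : {symmetric V}).

Lemma symC u v : g u v = g v u.
Proof. by rewrite hermC expr0 mul1r. Qed.

Lemma nondegenerate_inj u v :
  nondegenerate g -> (forall w, g u w = g v w) -> u = v.
Proof.
move=> /eqP g0 guv; apply/eqP; rewrite -subr_eq0 -memv0 -g0.
by apply/mem_orthovP => w _; rewrite linearBl /= guv subrr.
Qed.

Lemma nonnull_proj X v : nonnull g X ->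
  v - (g v X / eps g X) *: X \in orthov g <[X]>.
Proof.
by move=> X0; rewrite mem_orthov1 linearBl /= linearZl_LR /= divfK // subrr.
Qed.

Lemma basis_cons_perp X (s : seq V) : nonnull g X ->
  basis_of (orthov g <[X]>) s -> basis_of fullv (X :: s).
Proof.
move=> X0 bs; apply/andP; split.
  rewrite eqEsubv subvf /= span_cons (span_basis bs); apply/subvP => v _.
  rewrite -(subrK ((g v X / eps g X) *: X) v) addrC.
  by apply: memv_add; rewrite ?nonnull_proj // memvZ // memv_line.
by rewrite free_cons (span_basis bs) mem_orthov1 X0 (basis_free bs).
Qed.

Section Jacobi.
Hypothesis g_nondeg : nondegenerate g.
Variables (R : V -> V -> V -> V -> K) (R_curv : alg_curvature R).
Local Notation J := (jacobi g R).

Lemma jacobi_self_adjoint X u w : g (J X u) w = g u (J X w).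
Proof.
rewrite [RHS]symC !jacobiP // [RHS](alg_curvature_pair_sym R_curv).
by rewrite [RHS](curv_skew12 R_curv) (curv_skew34 R_curv u).
Qed.

Lemma jacobi_id X : J X X = 0.
Proof.
apply: nondegenerate_inj => // w; rewrite jacobiP // linear0l.
by have := curv_skew12 R_curv X X X w; lra.
Qed.

(** Project the eigenvectors [E] onto the orthogonal complement of [X] and keep a free spanning
    subfamily. Since [J X] is self-adjoint and kills [X], an eigenvector [e] for [a] satisfies
    [a * g e X = 0]: either [e] is already orthogonal to [X], or [a = 0]. In both cases its
    projection is again an eigenvector for [a]. *)
Lemma perp_eigenbasis X (E : seq V) : nonnull g X ->
  basis_of fullv E -> {in E, forall v, exists a, J X v = a *: v} ->
  exists (s : seq V) (b : V -> K), basis_of (orthov g <[X]>) s /\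
    {in s, forall v, J X v = b v *: v}.
Proof.
move=> X0 bE EE; pose pr v := v - (g v X / eps g X) *: X.
have pr_lin : linear pr.
  move=> a u v; rewrite /pr linearPl /= mulrDl scalerDl opprD addrACA.
  by rewrite scalerBr scalerA mulrA.
pose prL : {linear V -> V} :=
  HB.pack pr (GRing.isLinear.Build K V V _ pr pr_lin).
have [s [sE fs ss]] := exists_free_subseq (map prL E).
have sP : {in s, forall v, exists a, J X v = a *: v}.
  move=> v /sE/mapP[e eE ->]; have [a ae] := EE e eE; exists a.
  rewrite /= /pr linearB linearZ /= jacobi_id scaler0 subr0 ae.
  have /eqP := jacobi_self_adjoint X e X.
  rewrite jacobi_id linear0r ae linearZl_LR mulf_eq0.
  by case/orP => /eqP ->; rewrite ?mul0r ?scale0r ?subr0.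
have [b bP] : exists b : V -> K, forall v, v \in s -> J X v = b v *: v.
  have /choice[b bP] : forall v, exists a, v \in s -> J X v = a *: v.
    move=> v; have [vs|vNs] := boolP (v \in s); last by exists 0.
    by have [a aE] := sP v vs; exists a.
  by exists b.
exists s, b; split=> //.
rewrite /basis_of fs andbT ss eqEsubv; apply/andP; split.
  by apply/span_subvP => _ /mapP[v _ ->]; apply: nonnull_proj.
apply/subvP => v; rewrite mem_orthov1 => /eqP vX.
have -> : v = prL v by rewrite /= /pr vX mul0r scale0r subr0.
have : v \in <<E>>%VS by rewrite (span_basis bE) memvf.
case/(free_span (basis_free bE)) => c -> _; rewrite linear_sum big_seq.
by apply: memv_suml => e eE; rewrite [X in X \in _]linearZ memvZ // memv_span ?map_f.
Qed.

Lemma red_jacobi_char_poly X (s : seq V) (b : V -> K) :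
  basis_of (orthov g <[X]>) s -> {in s, forall v, J X v = b v *: v} ->
  lfun_char_poly (red_jacobi g R X) = \prod_(v <- s) ('X - (b v)%:P).
Proof.
move=> bs sE; have sK : {in s, cancel (vsproj (orthov g <[X]>)) vsval}.
  by move=> v vs; rewrite vsprojK // (basis_mem bs).
rewrite (lfun_char_poly_eigenbasis (b := b \o vsval) (basis_vsproj bs)).
  by rewrite big_map; apply: eq_big_seq => v vs; rewrite /= sK.
move=> _ /mapP[v vs ->]; apply: subvs_inj.
by rewrite red_jacobiP // linearZ /= sK // sE.
Qed.

Lemma mem_jacobi_space k (lam : 'I_k -> K) X (i : 'I_k) w :
  w \in jacobi_space g R lam X (lift ord0 i) =
  (w \in orthov g <[X]>) && (J X w == (eps g X * lam i) *: w).
Proof.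
rewrite /jacobi_space liftK; apply/memv_imgP/andP.
  case=> u; rewrite memv_ker add_lfunE opp_lfunE scale_lfunE id_lfunE.
  rewrite subr_eq0 => /eqP uE ->; rewrite lfunE /= subvsP; split=> //.
  by rewrite -red_jacobiP // uE.
case=> wX /eqP wE; exists (vsproj _ w); last by rewrite lfunE /= vsprojK.
rewrite memv_ker add_lfunE opp_lfunE scale_lfunE id_lfunE subr_eq0.
by apply/eqP/subvs_inj; rewrite red_jacobiP // linearZ /= vsprojK.
Qed.

Lemma jacobi_space0 k (lam : 'I_k -> K) X :
  jacobi_space g R lam X ord0 = <[X]>%VS.
Proof. by rewrite /jacobi_space unlift_none. Qed.

Lemma jacobi_space_orthogonal k (lam : 'I_k -> K) X (i j : 'I_k.+1) u w :
  injective lam -> nonnull g X -> i != j ->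
  u \in jacobi_space g R lam X i -> w \in jacobi_space g R lam X j -> g u w = 0.
Proof.
move=> lam_inj X0; have perp0 l v w' : v \in jacobi_space g R lam X ord0 ->
    w' \in jacobi_space g R lam X (lift ord0 l) -> g v w' = 0.
  rewrite jacobi_space0 mem_jacobi_space => /vlineP[c ->] /andP[+ _].
  by rewrite mem_orthov1 => /eqP wX; rewrite symC linearZr_LR /= wX mulr0.
have [i' ->|->] := unliftP ord0 i; have [j' ->|->] := unliftP ord0 j.
- rewrite (inj_eq lift_inj) !mem_jacobi_space.
  move=> ij /andP[_ /eqP uE] /andP[_ /eqP wE].
  have := jacobi_self_adjoint X u w.
  rewrite uE wE linearZl_LR linearZr_LR /= => /eqP.
  rewrite -subr_eq0 -mulrBl -mulrBr !mulf_eq0 (negbTE X0) subr_eq0 /=.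
  by rewrite (inj_eq lam_inj) (negbTE ij) => /eqP.
- by move=> _ uX wX; rewrite symC; apply: perp0 wX uX.
- by move=> _; apply: perp0.
- by rewrite eqxx.
Qed.

End Jacobi.
End ScalarProduct.

(** * A curvature tensor with prescribed Jacobi forms *)

Section CurvatureFromJacobiForms.
Variables (K : realType) (V : vectType K) (g : {symmetric V}).
Variables (n : nat) (E : n.-tuple V) (S : V -> V -> V -> K).

Hypotheses (E_basis : basis_of fullv E).
(** The factor 2 handles indefinite signature: for an orthonormal basis the sum of two members may
    be null, while [E_a + 2 E_b] has square 1 or -1 plus 4 or -4, or else 9 or -9 when [a = b]. *)
Hypotheses (E_nonnull : forall a : 'I_n, nonnull g E`_a)
  (E_nonnull2 : forall a b : 'I_n, nonnull g (E`_a + 2 *: E`_b)).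
Hypothesis S_linear : forall X W, scalar (fun Y => S X Y W).
Hypothesis S_sym : forall X Y W, nonnull g X -> S X Y W = S X W Y.
Hypothesis S_id : forall X W, nonnull g X -> S X X W = 0.
Hypothesis S_exchange : forall X Y, nonnull g X -> nonnull g Y ->
  S X Y Y = S Y X X.

Lemma scalar_expand (f : V -> K) Y : scalar f ->
  f Y = \sum_a coord E a Y * f E`_a.
Proof.
move=> f_lin; pose F := GRing.isLinear.Build K V K^o _ (f : V -> K^o) f_lin.
pose f' : {linear V -> K^o} := HB.pack (f : V -> K^o) F.
rewrite -[f Y]/(f' Y) {1}(coord_basis E_basis (memvf Y)) linear_sum.
by apply: eq_bigr => a _; rewrite linearZ.
Qed.

(** Polarization with nonnull vectors only: once the diagonal terms vanish, [q] at [E_a + 2 E_b]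
    reduces to [4 * q E_a E_b]. *)
Lemma sym_form_eq0 (q : V -> V -> K) :
  (forall Y, scalar (q^~ Y)) -> (forall X Y, q X Y = q Y X) ->
  (forall X, nonnull g X -> q X X = 0) -> forall X Y, q X Y = 0.
Proof.
move=> q_lin qC q0 X Y.
have qE0 (a b : 'I_n) : q E`_a E`_b = 0.
  have := q0 _ (E_nonnull2 a b); rewrite addrC q_lin !(qC _ (_ + _)) !q_lin.
  rewrite !q0 // (qC E`_b); lra.
rewrite (scalar_expand X (q_lin Y)) big1 // => a _.
rewrite qC (scalar_expand Y (q_lin _)) big1 ?mulr0 // => b _.
by rewrite qE0 mulr0.
Qed.

(** By exchange, for nonnull [X] the value at [(X, X)] is the polarization of [S X] that yields
    [S X E_a E_b]. The base points of [S] are fixed sample vectors, which makes the expression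
    bilinear in [X] and [X']. *)
Let beta (a b : 'I_n) (X X' : V) : K :=
  (S (E`_a + 2 *: E`_b) X X' - S E`_a X X' - 4 * S E`_b X X') / 4.

(* The biquadratic form (X, Y) |-> S X Y Y, polarized in both variables; S X
   is only meaningful for nonnull X, hence the choice of sample vectors. *)
Let T (X X' Y W : V) : K :=
  \sum_a \sum_b coord E a Y * coord E b W * beta a b X X'.

Let beta_linear a b X' : scalar (beta a b ^~ X').
Proof. by move=> c u v; rewrite /beta /= !S_linear; field. Qed.

Let beta_sym a b X X' : beta a b X X' = beta a b X' X.
Proof. by rewrite /beta !(S_sym X X'). Qed.

Let betaE a b X : nonnull g X -> beta a b X X = S X E`_a E`_b.
Proof.
move=> X0; rewrite /beta !(@S_exchange _ X) // (addrC E`_a) S_linear.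
by rewrite !(S_sym _ (_ + _)) // !S_linear (S_sym E`_b E`_a) //; field.
Qed.

Let T_linear1 X' Y W c u v :
  T (c *: u + v) X' Y W = c * T u X' Y W + T v X' Y W.
Proof.
rewrite /T mulr_sumr -big_split; apply: eq_bigr => a _.
rewrite /= mulr_sumr -big_split; apply: eq_bigr => b _.
by rewrite /= beta_linear; ring.
Qed.

Let T_linear3 X X' W c u v :
  T X X' (c *: u + v) W = c * T X X' u W + T X X' v W.
Proof.
rewrite /T mulr_sumr -big_split; apply: eq_bigr => a _.
rewrite /= mulr_sumr -big_split; apply: eq_bigr => b _.
by rewrite /= linearP /=; ring.
Qed.

Let T_sym1 X X' Y W : T X X' Y W = T X' X Y W.
Proof. by apply: eq_bigr => a _; apply: eq_bigr => b _; rewrite beta_sym. Qed.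

Let T_nonnull X Y W : nonnull g X -> T X X Y W = S X Y W.
Proof.
move=> X0; rewrite (scalar_expand Y (S_linear X W)); apply: eq_bigr => a _.
rewrite S_sym // (scalar_expand W (S_linear _ _)) mulr_sumr.
by apply: eq_bigr => b _; rewrite betaE // -mulrA S_sym.
Qed.

(** The difference is a symmetric bilinear form in [X], [X']. For nonnull [X] its diagonal value is
    [S X Y W - S X W Y = 0], so it vanishes by polarization. *)
Let T_sym2 X X' Y W : T X X' Y W = T X X' W Y.
Proof.
apply/eqP; rewrite -subr_eq0; apply/eqP.
apply: (@sym_form_eq0 (fun X X' => T X X' Y W - T X X' W Y)).
- by move=> Z c u v; rewrite !T_linear1; ring.
- by move=> Z Z'; rewrite !(T_sym1 Z).
- by move=> Z Z0; rewrite !T_nonnull // S_sym // subrr.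
Qed.

Let T_linear2 X Y W c u v :
  T X (c *: u + v) Y W = c * T X u Y W + T X v Y W.
Proof. by rewrite !(T_sym1 X) T_linear1. Qed.

Let T_linear4 X X' Y c u v :
  T X X' Y (c *: u + v) = c * T X X' Y u + T X X' Y v.
Proof. by rewrite !(T_sym2 _ _ Y) T_linear3. Qed.

(** Two polarizations: [S_exchange] settles the case of two diagonal pairs with nonnull entries,
    then one pair is freed, then the other. *)
Let T_pair_sym X X' Y W : T X X' Y W = T Y W X X'.
Proof.
have T_pair Z U U' : nonnull g Z -> T Z Z U U' = T U U' Z Z.
  move=> Z0; apply/eqP; rewrite -subr_eq0; apply/eqP; move: U U'.
  apply: (@sym_form_eq0 (fun U U' => T Z Z U U' - T U U' Z Z)).
  - by move=> Y' c u v; rewrite T_linear1 T_linear3; ring.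
  - by move=> Y' Y''; rewrite T_sym2 (T_sym1 Y').
  - by move=> Y' Y0; rewrite !T_nonnull // S_exchange // subrr.
apply/eqP; rewrite -subr_eq0; apply/eqP; move: X X'.
apply: (@sym_form_eq0 (fun X X' => T X X' Y W - T Y W X X')).
- by move=> X' c u v; rewrite T_linear1 T_linear3; ring.
- by move=> Z Z'; rewrite T_sym1 (T_sym2 Y).
- by move=> Z Z0; rewrite T_pair // subrr.
Qed.

(* The derivative in the direction Y of the identity T Z Z Z W = 0, valid for
   all nonnull Z, in particular on the line X + t Y outside finitely many t. *)
Let T_derive X Y W : nonnull g X -> T X X Y W + 2 * T X Y X W = 0.
Proof.
move=> X0; have T0 : T X X X W = 0 by rewrite T_nonnull // S_id.
(* [p] and [r] expand in [t] the values [T Z Z Z W] and [eps g Z] at [Z = t *: Y + X]. The constant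
   term of [p] is 0 by [T0]; the coefficient of [t] is the quantity to kill. *)
pose p : {poly K} := Poly [:: 0; T X X Y W + 2 * T X Y X W;
  T Y Y X W + 2 * T X Y Y W; T Y Y Y W].
pose r : {poly K} := Poly [:: eps g X; 2 * g X Y; eps g Y].
have Tpt t : T (t *: Y + X) (t *: Y + X) (t *: Y + X) W = p.[t].
  rewrite horner_Poly /= !T_linear1 !T_linear2 !T_linear3 T0.
  rewrite !(T_sym1 Y X); ring.
have rE t : eps g (t *: Y + X) = r.[t].
  rewrite horner_Poly /= /eps !linearPl /= !linearPr /= (symC g Y X); ring.
(* Where [r] does not vanish, [t *: Y + X] is nonnull and [p] vanishes. *)
have pr_root t : root (p * r) t.
  rewrite rootM orbC; case: (boolP (root r t)) => //=.
  rewrite !/(root _ t) -rE -Tpt.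
  by move=> t0; rewrite T_nonnull // S_id // eqxx.
have pr0 : p * r = 0.
  (* The product has degree at most 3 + 2, so the six roots 0, ..., 5 force it to be zero. *)
  apply: (@roots_geq_poly_eq0 _ _ [seq i%:R | i <- iota 0 6]).
  - by apply/allP => t _; apply: pr_root.
  - rewrite map_inj_uniq ?iota_uniq // => i j /eqP; rewrite eqr_nat => /eqP //.
  - rewrite size_map size_iota (leq_trans (size_mul_leq _ _)) //.
    rewrite -subn1 leq_subLR.
    have sp : (size p <= 4)%N by exact: size_Poly.
    have sr : (size r <= 3)%N by exact: size_Poly.
    exact: leq_add sp sr.
have r0 : r != 0.
  apply: contraNneq X0 => r0; have := rE 0.
  by rewrite r0 horner0 scale0r add0r => ->.
move/eqP: pr0; rewrite mulf_eq0 (negbTE r0) orbF => /eqP p0.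
by have := coef_Poly [:: 0; T X X Y W + 2 * T X Y X W;
  T Y Y X W + 2 * T X Y Y W; T Y Y Y W] 1%N; rewrite -/p p0 coef0 /= => <-.
Qed.

Lemma curvature_of_jacobi_forms :
  exists R : V -> V -> V -> V -> K, alg_curvature R /\
    forall X Y W, nonnull g X -> R Y X X W = S X Y W.
Proof.
exists (fun A B C D => 2 / 3 * (T B C A D - T A C B D)); split; last first.
  (* [T_derive] gives [T X Y X W = - T X X Y W / 2], so the difference of the two terms is 3/2 of
     [S X Y W]; this fixes the factor 2/3. *)
  move=> X Y W X0; rewrite -T_nonnull //.
  have := T_derive Y W X0; rewrite (T_sym1 X Y) => h; lra.
split.
- by move=> Y Z W c u v; rewrite !(T_linear1, T_linear3); ring.
- by move=> Y Z W c u v; rewrite !(T_linear1, T_linear3); ring.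
- by move=> Y Z W c u v; rewrite !T_linear2; ring.
- by move=> Y Z W c u v; rewrite !T_linear4; ring.
- by move=> X Y Z W; ring.
- by move=> X Y Z W; rewrite (T_pair_sym Y W) (T_pair_sym X W); ring.
- move=> X Y Z W; rewrite (T_sym1 Z Y) (T_sym1 Z X) (T_sym1 Y X); ring.
Qed.

End CurvatureFromJacobiForms.

(** * Reassigning the eigenvalues on the same eigenspaces *)

Lemma root_prod_XsubC_exp (F : fieldType) (k : nat) (l : 'I_k -> F)
    (nu : 'I_k -> nat) (a : F) :
  reflect (exists2 i, (0 < nu i)%N & a = l i)
    (root (\prod_i ('X - (l i)%:P) ^+ nu i) a).
Proof.
rewrite rootE horner_prod; apply: (iffP (prodf_eq0 _ _)) => -[j].
  move=> _; rewrite horner_exp hornerXsubC expf_eq0 => /andP[n0].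
  by rewrite subr_eq0 => /eqP al; exists j.
move=> n0 ->; exists j => //.
by rewrite horner_exp hornerXsubC subrr expf_eq0 n0 eqxx.
Qed.

Section Reassign.
Variables (K : realType) (V : vectType K) (g : {symmetric V}).
Variables (k : nat) (lam mu : 'I_k -> K) (nu : 'I_k -> nat).
Hypotheses (g_nondeg : nondegenerate g) (lam_inj : injective lam).
Variable R : V -> V -> V -> V -> K.
Hypothesis R_curv : alg_curvature R.
Hypothesis R_char : forall X, nonnull g X -> lfun_char_poly (red_jacobi g R X) =
  \prod_(i < k) ('X - (eps g X * lam i)%:P) ^+ nu i.

(** The factorization alone would allow [nu i = 0]. The [k] distinct complex roots all lie among the
    [k] numbers [eps g X * lam j], so by counting every one of these is a root. *)
Lemma red_eigenvalues_of_k_root : k_root g R k -> red_eigenvalues g R lam.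
Proof.
move=> R_root; split=> // X X0 a; have [s [s_uniq s_size sE]] := R_root X X0.
rewrite leigenvalue_root R_char //; split.
  by case/root_prod_XsubC_exp => i _ ->; exists i.
case=> i ->; rewrite -(fmorph_root (real_complex K)) -R_char // -sE.
pose root_lam j := real_complex K (eps g X * lam j).
pose t := codom root_lam.
have st : {subset s <= t}.
  move=> z zs; have := zs; rewrite sE R_char // rmorph_prod /=.
  under eq_bigr do rewrite rmorphXn /= map_polyXsubC.
  case/root_prod_XsubC_exp => j _ ->; exact: (codom_f root_lam).
have [|_ ->] := uniq_min_size s_uniq st.
  by rewrite size_codom card_ord s_size.
exact: (codom_f root_lam).
Qed.

(** The last clause records the spectrum in two scalings: the first serves the reduced operator, the
    second the normalized operator in the Osserman condition. *)
Definition reassigned_jacobi (X : V) (J' : 'End(V)) : Prop :=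
  [/\ J' X = 0,
      forall i w, w \in jacobi_space g R lam X (lift ord0 i) ->
        J' w = (eps g X * mu i) *: w,
      forall Y, exists2 Ys : 'I_k.+1 -> V,
        forall i, Ys i \in jacobi_space g R lam X i & Y = \sum_i Ys i &
      exists (s : seq V) (b : V -> K), [/\ basis_of (orthov g <[X]>) s,
        {in s, forall v, J' v = b v *: v},
        \prod_(v <- s) ('X - (b v)%:P) =
          \prod_i ('X - (eps g X * mu i)%:P) ^+ nu i &
        \prod_(v <- s) ('X - ((eps g X)^-1 * b v)%:P) =
          \prod_i ('X - (mu i)%:P) ^+ nu i]].

Lemma exists_reassigned_jacobi X : jacobi_diagonalizable g R ->
  nonnull g X -> exists J', reassigned_jacobi X J'.
Proof.
move=> R_diag X0; have [E [bE _ _ EE]] := R_diag X X0.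
have [|s [b [bs sE]]] := perp_eigenbasis g_nondeg R_curv X0 bE.
  by move=> _ /tnthP[i ->]; apply: EE.
have := red_jacobi_char_poly g_nondeg R_curv bs sE.
rewrite R_char // -(big_map b predT (fun c => 'X - c%:P)) => /esym bP.
(* [h] sends each old eigenvalue to the new one; it is well defined as [X] is nonnull and [lam]
   injective. The default 0 is never taken at an eigenvalue. *)
pose h c :=
  if [pick i | eps g X * lam i == c] is Some i then eps g X * mu i else 0.
have hE i : h (eps g X * lam i) = eps g X * mu i.
  rewrite /h; case: pickP => [j /eqP/(mulfI X0)/lam_inj -> //|/(_ i)].
  by rewrite eqxx.
have bXs := basis_cons_perp X0 bs; have fXs := basis_free bXs.
have [J' J'E] :=
  exists_lfun_of_free (fun v => if v == X then 0 else h (b v) *: v) fXs.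
have sX v : v \in s -> (v == X) = false.
  move=> vs; apply: contraNF X0 => /eqP vX.
  by have := basis_mem bs vs; rewrite mem_orthov1 vX.
have J's : {in s, forall v, J' v = h (b v) *: v}.
  by move=> v vs; rewrite J'E ?inE ?vs ?orbT // sX.
exists J'; split.
- by rewrite J'E ?mem_head // eqxx.
- move=> i w; rewrite mem_jacobi_space // => /andP[wX /eqP wE].
  rewrite -hE; apply: eigenvec_transfer (basis_free bs) sE J's _ _ _ wE.
  by rewrite (span_basis bs).
- move=> Y; suff : Y \in (\sum_i jacobi_space g R lam X i)%VS.
    by case/memv_sumP => Ys YsE ->; exists Ys => // i; apply: YsE.
  have : Y \in <<X :: s>>%VS by rewrite (span_basis bXs) memvf.
  apply/subvP/span_subvP => v; rewrite inE => /orP[/eqP ->|vs].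
    apply: (subvP (sumv_sup ord0 _ (subvv _))) => //.
    by rewrite jacobi_space0 memv_line.
  (* [b v] is a root of the characteristic polynomial, hence some [eps g X * lam i], which places
     [v] in the matching eigenspace. *)
  have : root (\prod_(c <- map b s) ('X - c%:P)) (b v).
    by rewrite root_prod_XsubC map_f.
  rewrite bP => /root_prod_XsubC_exp[i _ bv].
  apply: (subvP (sumv_sup (lift ord0 i) _ (subvv _))) => //.
  by rewrite mem_jacobi_space // (basis_mem bs) //= sE // bv.
- exists s, (h \o b); split=> //.
    rewrite -(big_map b predT (fun c => 'X - (h c)%:P)) (prod_XsubC_map _ bP).
    by under eq_bigr do rewrite hE.
  rewrite -(big_map b predT (fun c => 'X - ((eps g X)^-1 * h c)%:P)).
  rewrite (prod_XsubC_map (fun c => (eps g X)^-1 * h c) bP).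
  by under eq_bigr do rewrite hE mulKf //.
Qed.

Lemma reassigned_jacobi_form X J' (Ys : 'I_k.+1 -> V) W : nonnull g X ->
  reassigned_jacobi X J' ->
  (forall i, Ys i \in jacobi_space g R lam X i) ->
  g (J' (\sum_i Ys i)) W = eps g X *
    \sum_i (if unlift ord0 i is Some j then mu j else 0) * g (Ys i) W.
Proof.
move=> X0 [J'X J'E _ _] YsE; rewrite linear_sum linear_sumlz mulr_sumr.
apply: eq_bigr => i _; have := YsE i.
case: unliftP => [j ->|->] Yi.
  by rewrite /= (J'E j) // linearZl_LR /= mulrA.
move: Yi; rewrite jacobi_space0 => /vlineP[c ->].
by rewrite /= linearZ /= J'X scaler0 linear0l mul0r mulr0.
Qed.

(** Orthogonality of the eigenspaces removes the cross terms. The resulting sum is visibly symmetric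
    in [Ys] and [Ws], and for [Ys = Ws] it involves only the [eps g (Ys i)]. *)
Lemma reassigned_jacobi_form_diag X J' (Ys Ws : 'I_k.+1 -> V) : nonnull g X ->
  reassigned_jacobi X J' ->
  (forall i, Ys i \in jacobi_space g R lam X i) ->
  (forall i, Ws i \in jacobi_space g R lam X i) ->
  g (J' (\sum_i Ys i)) (\sum_i Ws i) = eps g X *
    \sum_i (if unlift ord0 i is Some j then mu j else 0) * g (Ys i) (Ws i).
Proof.
move=> X0 J'P YsE WsE; rewrite (reassigned_jacobi_form _ X0 J'P YsE).
congr (_ * _); apply: eq_bigr => i _; congr (_ * _).
rewrite linear_sumr (bigD1 i) //= big1 ?addr0 // => j ji.
by apply: jacobi_space_orthogonal (YsE i) (WsE j) => //; rewrite eq_sym.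
Qed.

End Reassign.

(** * Construction of the new Osserman tensor *)

Theorem theorem2 (K : realType) (V : vectType K) (g : {symmetric V})
    (k : nat) (lam : 'I_k -> K) (nu : 'I_k -> nat) :
  nondegenerate g ->
  injective lam ->
  (exists R : V -> V -> V -> V -> K,
    [/\ alg_curvature R, osserman g R, k_root g R k,
        jacobi_diagonalizable g R & jacobi_proportional g R k] /\
    forall X : V, nonnull g X ->
      lfun_char_poly (red_jacobi g R X) =
        \prod_(i < k) ('X - (eps g X * lam i)%:P) ^+ nu i) ->
  forall mu : 'I_k -> K,
  exists R' : V -> V -> V -> V -> K,
    [/\ alg_curvature R', osserman g R' &
        forall X : V, nonnull g X ->
          lfun_char_poly (red_jacobi g R' X) =
            \prod_(i < k) ('X - (eps g X * mu i)%:P) ^+ nu i].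
Proof.
move=> g_nondeg lam_inj [R [[R_curv _ R_root R_diag R_prop] R_char]] mu.
(* Without nonnull vectors every condition on the spectrum is vacuous and the zero tensor will
   do. *)
have [[Z Z0]|no_nonnull] := pselect (exists Z, nonnull g Z); last first.
  exists (fun _ _ _ _ => 0); split.
  - by split=> * => [c u v|c u v|c u v|c u v|||] /=;
      rewrite ?mulr0 ?addr0 ?oppr0.
  - by move=> X Y X0; case: no_nonnull; exists X.
  - by move=> X X0; case: no_nonnull; exists X.
have lamP := red_eigenvalues_of_k_root lam_inj R_char R_root.
have /choice[J' J'P] : forall X, exists J',
    nonnull g X -> reassigned_jacobi g lam mu nu R X J'.
  move=> X; have [X0|] := pselect (nonnull g X); last by exists 0.
  have [J' ?] :=
    exists_reassigned_jacobi mu g_nondeg lam_inj R_curv R_char R_diag X0.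
  by exists J'.
pose S X Y W : K := g (J' X Y) W.
have dec X (X0 : nonnull g X) := let: And4 _ _ d _ := J'P X X0 in d.
have formE X (X0 : nonnull g X) Ys Ws :=
  @reassigned_jacobi_form_diag _ _ _ _ _ mu nu g_nondeg lam_inj _ R_curv
    X (J' X) Ys Ws X0 (J'P X X0).
have S_linear X W : scalar (fun Y => S X Y W).
  by move=> c u v; rewrite /S linearP linearPl.
have S_sym X Y W : nonnull g X -> S X Y W = S X W Y.
  move=> X0; have [Ys YsE ->] := dec X X0 Y; have [Ws WsE ->] := dec X X0 W.
  rewrite /S !formE //.
  by under eq_bigr do rewrite symC.
have S_id X W : nonnull g X -> S X X W = 0.
  by move=> X0; have [J'X _ _ _] := J'P X X0; rewrite /S J'X linear0l.
have S_exchange X Y : nonnull g X -> nonnull g Y -> S X Y Y = S Y X X.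
  move=> X0 Y0; have [Ys YsE YE] := dec X X0 Y; have [Xs XsE XE] := dec Y Y0 X.
  have prop := R_prop lam lamP X Y Xs Ys X0 Y0 XsE XE YsE YE.
  have -> : S X Y Y = eps g X *
      \sum_i (if unlift ord0 i is Some j then mu j else 0) * eps g (Ys i).
    by rewrite /S YE formE.
  have -> : S Y X X = eps g Y *
      \sum_i (if unlift ord0 i is Some j then mu j else 0) * eps g (Xs i).
    by rewrite /S XE formE.
  (* Jacobi-proportionality matches the two sums term by term, whatever the weights [mu j]. *)
  by rewrite !mulr_sumr; apply: eq_bigr => i _; rewrite mulrCA prop mulrCA.
(* Diagonalizability at [Z] supplies the orthonormal basis behind the sample vectors. *)
have [E [bE Eo En _]] := R_diag Z Z0.
have E_nonnull (i : 'I_(\dim {:V})) : nonnull g E`_i.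
  rewrite -tnth_nth /nonnull /eps.
  by case: (En i) => ->; rewrite ?oppr_eq0 oner_eq0.
have E_nonnull2 (i j : 'I_(\dim {:V})) : nonnull g (E`_i + 2 *: E`_j).
  rewrite -!tnth_nth /nonnull; set u := tnth E i; set v := tnth E j.
  have -> : eps g (u + 2 *: v) = eps g u + 4 * g u v + 4 * eps g v.
    by rewrite addrC /eps linearPl /= !linearPr /= (symC g v u); ring.
  have [ij|/Eo uv] := eqVneq i j; last rewrite uv.
    by rewrite /u ij -/v /eps; case: (En j) => ->; apply/eqP; lra.
  by rewrite /eps; case: (En i) => ->; case: (En j) => ->; apply/eqP; lra.
have [R' [R'_curv R'E]] := curvature_of_jacobi_forms bE E_nonnull E_nonnull2
  S_linear S_sym S_id S_exchange.
have jacobiE X : nonnull g X -> jacobi g R' X = J' X.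
  move=> X0; apply/lfunP => Y; apply: (nondegenerate_inj g_nondeg) => W.
  by rewrite jacobiP // R'E.
(* The extra factor ['X] is the eigenvalue 0 on [X] itself. The right-hand side does not mention
   [X], which is the Osserman condition. *)
have charE X : nonnull g X ->
    lfun_char_poly ((eps g X)^-1 *: jacobi g R' X) =
    'X * \prod_i ('X - (mu i)%:P) ^+ nu i.
  move=> X0; have [J'X _ _ [s [b [bs sE _ <-]]]] := J'P X X0.
  pose c v := if v == X then 0 else (eps g X)^-1 * b v.
  have cs : {in s, forall v, c v = (eps g X)^-1 * b v}.
    move=> v vs; rewrite /c; case: eqVneq => // vX.
    have := basis_mem bs vs; rewrite mem_orthov1 vX => gX0.
    by move: X0; rewrite /nonnull /eps gX0.
  rewrite (lfun_char_poly_eigenbasis (b := c) (basis_cons_perp X0 bs)).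
    rewrite big_cons /c eqxx subr0; congr (_ * _).
    by apply: eq_big_seq => v vs; rewrite -/(c v) cs.
  move=> v; rewrite inE jacobiE // scale_lfunE => /orP[/eqP ->|vs].
    by rewrite J'X /c eqxx scaler0 scale0r.
  by rewrite sE // cs // scalerA.
exists R'; split=> //.
- by move=> X Y X0 Y0; rewrite !charE.
- move=> X X0; have [_ _ _ [s [b [bs sE <- _]]]] := J'P X X0.
  by apply: red_jacobi_char_poly => // v vs; rewrite jacobiE // sE.
Qed.
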